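(* Let $s \in \mathbb{N}=\{1,2,3,\dots\}$. For all $m_1,\ldots,m_s,n_1,\ldots,n_s,k \in \mathbb{Z}_+=\{0,1,2,\dots\}$ with $m_1n_1+\cdots+m_sn_s > (m_1+\cdots+m_s)k$, $$\sum_{j=0}^{\sum_{i=1}^s n_im_i-k\sum_{i=1}^s m_i}\binom{\sum_{i=1}^s n_im_i-k\sum_{i=1}^s m_i}{j}(-1)^jE_{k\sum_{i=1}^{s}m_i+j} = \begin{cases} 2+E_{m_1n_1+\cdots+m_sn_s} & \text{if } k=0,\\[2mm] \displaystyle\sum_{j=0}^{k\sum_{i=1}^s m_i}\binom{k\sum_{i=1}^s m_i}{j}(-1)^{k\sum_{i=1}^s m_i-j}E_{\sum_{i=1}^{s}n_im_i-j} & \text{if } k>0.\end{cases}$$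
   Context: The Euler numbers $E_n\in\mathbb{Q}$ ($n\ge 0$) are defined by $\frac{2}{e^t+1} = \sum_{n=0}^{\infty} E_n \frac{t^n}{n!}$. *)

(* Defs.v *)
From HB Require Import structures.
From mathcomp Require Import all_boot all_order all_algebra.
Set Implicit Arguments.
Unset Strict Implicit.
Unset Printing Implicit Defensive.
Import GRing.Theory.
Local Open Scope ring_scope.

(* A formal power series in t over rat, given by its coefficients. *)
Definition fps := nat -> rat.

Definition fps_const (c : rat) : fps := fun n => if n is 0%N then c else 0.

Definition fps_add (f g : fps) : fps := fun n => f n + g n.

Definition fps_mul (f g : fps) : fps :=
  fun n => \sum_(i < n.+1) f i * g (n - i)%N.

(* The first n coefficients of the multiplicative inverse of f, obtained by
   solving f * g = 1 degree by degree; meaningful only when f 0 != 0. *)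
Fixpoint fps_inv_coefs (f : fps) (n : nat) : seq rat :=
  if n is n'.+1 then
    let g := fps_inv_coefs f n' in
    rcons g
      ((fps_const 1 n' - \sum_(i < n') f i.+1 * g`_(n' - i.+1)) / f 0%N)
  else [::].

Definition fps_inv (f : fps) : fps := fun n => (fps_inv_coefs f n.+1)`_n.

Definition fps_div (f g : fps) : fps := fps_mul f (fps_inv g).

Definition fps_exp : fps := fun n => (n`!%:R)^-1.

(* The exponential generating function \sum_n a_n t^n / n!. *)
Definition egf (a : nat -> rat) : fps := fun n => a n / n`!%:R.

(* 2 / (e^t + 1) = \sum_n (euler n) t^n / n!; this is the convention with
   euler 0 = 1, euler 1 = -1/2, i.e. the values at 0 of the Euler polynomials,
   not the coefficients of 1 / cosh t. *)
Definition euler (n : nat) : rat :=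
  n`!%:R * fps_div (fps_const 2) (fps_add fps_exp (fps_const 1)) n.

Lemma size_fps_inv_coefs f n : size (fps_inv_coefs f n) = n.
Proof. by elim: n => //= n IHn; rewrite size_rcons IHn. Qed.

Lemma nth_fps_inv_coefs f n i :
  (i < n)%N -> (fps_inv_coefs f n)`_i = fps_inv f i.
Proof.
elim: n => // n IHn; rewrite ltnS leq_eqVlt => /orP[/eqP -> //|lt_in].
by rewrite /= nth_rcons size_fps_inv_coefs lt_in IHn.
Qed.

Lemma fps_mulV f : f 0%N != 0 -> fps_mul f (fps_inv f) =1 fps_const 1.
Proof.
move=> f0 n; rewrite /fps_mul big_ord_recl subn0.
have -> : \sum_(i < n) f (lift ord0 i) * fps_inv f (n - lift ord0 i)%N =
          \sum_(i < n) f i.+1 * (fps_inv_coefs f n)`_(n - i.+1).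
  apply: eq_bigr => i _; rewrite lift0 nth_fps_inv_coefs //.
  by rewrite ltn_subrL /= (leq_ltn_trans _ (ltn_ord i)).
rewrite {1}/fps_inv /= nth_rcons size_fps_inv_coefs ltnn eqxx.
by rewrite mulrC divfK // subrK.
Qed.

Lemma fps_mul_unique f g h :
  f 0%N != 0 -> fps_mul f g =1 fps_mul f h -> g =1 h.
Proof.
move=> f0 eq_fgh n; elim/ltn_ind: n => n IHn.
have := eq_fgh n; rewrite /fps_mul !big_ord_recl !subn0.
rewrite (eq_bigr (fun i : 'I_n => f (lift ord0 i) * h (n - lift ord0 i)%N)).
  by move/addIr/(mulfI f0).
move=> i _; rewrite lift0 IHn // ltn_subrL /=.
exact: leq_ltn_trans (ltn_ord i).
Qed.

Lemma egf_euler :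
  egf euler =1 fps_div (fps_const 2) (fps_add fps_exp (fps_const 1)).
Proof.
move=> n; rewrite /egf /euler mulrC mulKf //.
by rewrite Num.Theory.pnatr_eq0 -lt0n fact_gt0.
Qed.

Lemma fps_constM c f n : fps_mul (fps_const c) f n = c * f n.
Proof.
by rewrite /fps_mul big_ord_recl subn0 big1 ?addr0 // => i _; rewrite mul0r.
Qed.

Lemma mul_egf_euler :
  fps_mul (fps_add fps_exp (fps_const 1)) (egf euler) =1 fps_const 2.
Proof.
move=> n; set f := fps_add _ _; have f0 : f 0%N != 0 by [].
transitivity (2 * fps_mul f (fps_inv f) n).
  rewrite /fps_mul mulr_sumr; apply: eq_bigr => i _.
  by rewrite egf_euler /fps_div fps_constM mulrCA.
by rewrite fps_mulV //; case: n => //= _; rewrite mulr0.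
Qed.

Lemma euler_unique (a : nat -> rat) :
  fps_mul (fps_add fps_exp (fps_const 1)) (egf a) =1 fps_const 2 ->
  a =1 euler.
Proof.
move=> Ha n; have f0 : fps_add fps_exp (fps_const 1) 0%N != 0 by [].
have eq_egf : egf a =1 egf euler.
  by apply: (fps_mul_unique f0) => i; rewrite Ha mul_egf_euler.
have /divIf eq_a := eq_egf n; apply: eq_a.
by rewrite Num.Theory.pnatr_eq0 -lt0n fact_gt0.
Qed.

(* Main.v *)
Require Import Defs.
From HB Require Import structures.
From mathcomp Require Import all_boot all_order all_algebra.
From mathcomp Require Import ring.
Import GRing.Theory.
Local Open Scope ring_scope.

(** Let [L] be the linear functional on polynomials with [L X^n = E_n]. The
    defining series gives [L (p (X + 1)) + L p = 2 p(0)], and this relation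
    determines [L]. Since [p |-> L (p (-1 - X))] satisfies it too, the two
    functionals agree. Applying both facts to [q (1 - X)] yields
    [L (q (1 - X)) = L q + 2 q(1) - 2 q(0)], and the theorem is the case
    [q = X^K (1 - X)^a], where [K] is the sum of the [k m_i] and [K + a] is the
    sum of the [n_i m_i]. *)

Definition umbral (a : nat -> rat) (p : {poly rat}) : rat :=
  \sum_(i < size p) p`_i * a i.

Lemma umbral_widen a (p : {poly rat}) N :
  (size p <= N)%N -> umbral a p = \sum_(i < N) p`_i * a i.
Proof.
move=> le_pN; rewrite /umbral (big_ord_widen N (fun i => p`_i * a i)) //.
rewrite big_mkcond; apply: eq_bigr => i _; case: ltnP => // le_pi.
by rewrite nth_default // mul0r.
Qed.

Fact umbral_is_linear a : scalar (umbral a).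
Proof.
move=> c p q; pose N := maxn (size p) (size q).
rewrite !(umbral_widen a _ N) ?leq_maxl ?leq_maxr //; last first.
  rewrite (leq_trans (size_polyD _ _)) // geq_max leq_maxr andbT.
  by rewrite (leq_trans (size_scale_leq _ _)) ?leq_maxl.
rewrite mulr_sumr -big_split; apply: eq_bigr => i _ /=.
by rewrite coefD coefZ mulrDl mulrA.
Qed.

HB.instance Definition _ a :=
  GRing.isLinear.Build rat {poly rat} rat *%R (umbral a) (umbral_is_linear a).

Lemma umbralXn a n : umbral a 'X^n = a n.
Proof.
rewrite /umbral size_polyXn big_ord_recr /= coefXn eqxx mul1r big1 ?add0r //.
by move=> i _; rewrite coefXn ltn_eqF ?mul0r.
Qed.

(** Substituting [q] only changes the moment sequence, so identities between functionals reduce to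
    identities between sequences. *)
Lemma umbral_comp a p q :
  umbral a (p \Po q) = umbral (fun n => umbral a (q ^+ n)) p.
Proof.
rewrite comp_polyE linear_sum; apply: eq_bigr => i _.
by rewrite linearZ.
Qed.

Lemma umbral_exprD1 a q n :
  umbral a ((q + 1) ^+ n) = \sum_(j < n.+1) 'C(n, j)%:R * umbral a (q ^+ j).
Proof.
rewrite addrC exprDn linear_sum; apply: eq_bigr => j _.
by rewrite expr1n mul1r raddfMn mulr_natl.
Qed.

Lemma fps_mul_exp1_egf a n :
  fps_mul (fps_add fps_exp (fps_const 1)) (egf a) n =
    (\sum_(j < n.+1) 'C(n, j)%:R * a j + a n) / n`!%:R.
Proof.
have fact_neq0 i : i`!%:R != 0 :> rat.
  by rewrite Num.Theory.pnatr_eq0 -lt0n fact_gt0.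
have -> : fps_mul (fps_add fps_exp (fps_const 1)) (egf a) n =
          fps_mul fps_exp (egf a) n + fps_mul (fps_const 1) (egf a) n.
  by rewrite /fps_mul -big_split; apply: eq_bigr => i _; exact: mulrDl.
rewrite fps_constM mul1r mulrDl; congr (_ + _).
(* Reversal puts the index [i] on [a] and leaves [n - i] on the exponential. *)
rewrite mulr_suml (reindex_inj rev_ord_inj); apply: eq_bigr => i _ /=.
have le_in : (i <= n)%N by rewrite -ltnS.
have bin_neq0 : 'C(n, i)%:R != 0 :> rat.
  by rewrite Num.Theory.pnatr_eq0 -lt0n bin_gt0.
rewrite subSS bin_sub // -(bin_fact le_in) /fps_exp /egf !natrM.
by field; rewrite !fact_neq0 bin_neq0.
Qed.

Lemma euler_rec n :
  \sum_(j < n.+1) 'C(n, j)%:R * euler j + euler n = 2 * (n == 0%N)%:R.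
Proof.
have := mul_egf_euler n; rewrite fps_mul_exp1_egf.
move/(canRL (divfK _)) => ->; last by rewrite Num.Theory.pnatr_eq0 -lt0n fact_gt0.
by case: n => [|n] /=; rewrite ?mul0r ?mulr0.
Qed.

Lemma euler_rec_unique (a : nat -> rat) :
    (forall n, \sum_(j < n.+1) 'C(n, j)%:R * a j + a n = 2 * (n == 0%N)%:R) ->
  a =1 euler.
Proof.
move=> a_rec; apply: euler_unique => n; rewrite fps_mul_exp1_egf a_rec.
by case: n => [|n] /=; rewrite ?mulr0 ?mul0r.
Qed.

(** This makes the right side of the shift relation umbral too, so that it can be checked moment by
    moment with [euler_rec]. *)
Lemma umbral_horner0 c p : umbral (fun n => c * (n == 0%N)%:R) p = c * p.[0].
Proof.
rewrite horner_coef mulr_sumr; apply: eq_bigr => i _.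
by rewrite expr0n mulrCA.
Qed.

Lemma umbral_euler_shift p :
  umbral euler (p \Po ('X + 1)) + umbral euler p = 2 * p.[0].
Proof.
rewrite umbral_comp -umbral_horner0 /umbral -big_split; apply: eq_bigr => i _ /=.
rewrite -/(umbral euler _) umbral_exprD1 -mulrDr -euler_rec.
by under eq_bigr do rewrite umbralXn.
Qed.

Lemma umbral_euler_reflect p :
  umbral euler (p \Po (- 'X - 1)) = umbral euler p.
Proof.
rewrite umbral_comp; apply: eq_bigr => i _; congr (_ * _); move: {i}(i : nat).
apply: euler_rec_unique => n; rewrite -umbral_exprD1 subrK.
(* The shift of [(- 'X) ^+ n] is [(- 'X - 1) ^+ n], so this is the Euler recurrence for the
   reflected moments. *)
have := umbral_euler_shift ((- 'X) ^+ n).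
rewrite rmorphXn /= rmorphN /= comp_polyX opprD addrC => ->.
by rewrite !hornerE expr0n.
Qed.

Lemma umbral_euler_flip q :
  umbral euler (q \Po (1 - 'X)) = umbral euler q + 2 * q.[1] - 2 * q.[0].
Proof.
(* Since [1 - 'X] is [(- 'X - 1) + 2], two shifts and a reflection suffice; the shifts produce the
   terms in [q.[1]] and [q.[0]]. *)
have X1E : q \Po (1 - 'X) = ((q \Po ('X + 1)) \Po ('X + 1)) \Po (- 'X - 1).
  rewrite -!comp_polyA; congr (_ \Po _).
  by rewrite !rmorphD /= !comp_polyX !rmorph1 subrK addrC.
have := umbral_euler_shift (q \Po ('X + 1)); have := umbral_euler_shift q.
rewrite X1E umbral_euler_reflect horner_comp !hornerE => <- <-; ring.
Qed.

Lemma umbral_XnM1BXn e K a :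
  umbral e ('X^K * (1 - 'X) ^+ a) =
    \sum_(j < a.+1) 'C(a, j)%:R * (-1) ^+ j * e (K + j)%N.
Proof.
rewrite exprBn mulr_sumr linear_sum; apply: eq_bigr => j _.
rewrite expr1n mulr1 mulrnAr raddfMn mulrCA -exprD /=.
by rewrite -(rmorph_sign polyC) mul_polyC linearZ /= umbralXn -mulrA mulr_natl.
Qed.

(** The flip exchanges the exponents of ['X] and [1 - 'X]; the corrections are the values of
    ['X^a * (1 - 'X) ^+ K] at 1 and 0. *)
Lemma euler_sum_swap K a :
  \sum_(j < a.+1) 'C(a, j)%:R * (-1) ^+ j * euler (K + j) =
    \sum_(j < K.+1) 'C(K, j)%:R * (-1) ^+ j * euler (a + j)
      + 2 * (K == 0%N)%:R - 2 * (a == 0%N)%:R.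
Proof.
rewrite -!umbral_XnM1BXn.
have -> : 'X^K * (1 - 'X) ^+ a = ('X^a * (1 - 'X) ^+ K) \Po (1 - 'X) :> {poly rat}.
  rewrite rmorphM /= !rmorphXn /= rmorphB /= comp_polyX rmorph1.
  by rewrite subKr mulrC.
rewrite umbral_euler_flip !hornerE.
by rewrite /= subrr !expr1n !mulr1 !expr0n.
Qed.

Theorem corollary13 (s : nat) (hs : (0 < s)%N) (m n : 'I_s -> nat) (k : nat)
    (hmn : ((\sum_(i < s) m i) * k < \sum_(i < s) m i * n i)%N) :
  \sum_(j < ((\sum_(i < s) n i * m i) - k * (\sum_(i < s) m i)).+1)
      ('C((\sum_(i < s) n i * m i) - k * (\sum_(i < s) m i), j))%:R
        * (-1) ^+ j * euler (k * (\sum_(i < s) m i) + j)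
  = if k == 0%N then 2 + euler (\sum_(i < s) m i * n i)
    else \sum_(j < (k * (\sum_(i < s) m i)).+1)
           ('C(k * (\sum_(i < s) m i), j))%:R
             * (-1) ^+ (k * (\sum_(i < s) m i) - j)
             * euler ((\sum_(i < s) n i * m i) - j).
Proof.
have mnC : (\sum_(i < s) m i * n i = \sum_(i < s) n i * m i)%N.
  by apply: eq_bigr => i _; rewrite mulnC.
(* If all [m i] vanished, [hmn] would read 0 < 0. Positivity makes [k * M] zero exactly when [k]
   is. *)
have M_gt0 : (0 < \sum_(i < s) m i)%N.
  rewrite lt0n; apply: contraTneq hmn => /eqP; rewrite sum_nat_eq0 => /forallP m0.
  by rewrite -leqNgt big1 // => i _; rewrite (eqP (m0 i)).
move: hmn; rewrite mnC mulnC.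
move: (\sum_(i < s) n i * m i)%N (\sum_(i < s) m i)%N M_gt0 => N M M_gt0 lt_KN.
have /negPf a_neq0 : (N - k * M != 0)%N by rewrite -lt0n subn_gt0.
rewrite euler_sum_swap a_neq0 mulr0 subr0 muln_eq0 (gtn_eqF M_gt0) orbF.
case: eqP => [->|_].
  (* Only the term [j = 0] is left, and the 2 is the value at 1. *)
  by rewrite mul0n big_ord1 addn0 subn0 bin0 !mul1r mulr1 addrC.
(* Under [j -> k * M - j] the Euler index [(N - k * M) + j] becomes [N - j]. *)
rewrite mulr0 addr0 (reindex_inj rev_ord_inj); apply: eq_bigr => j _ /=.
have le_jK : (j <= k * M)%N by rewrite -ltnS.
by rewrite subSS bin_sub // addnBA // subnK // ltnW.
Qed.
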